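(* Let $(A, d_1, \ldots, d_N)$ be an AssHDer pair of rank $N$ and let $(\mu_t; d_{1,t}, \ldots, d_{N,t})$, with $\mu_t = \sum_{i=0}^n t^i \mu_i$ and $d_{k,t} = \sum_{i=0}^n t^i d_{k,i}$, be a deformation of order $n$ of it. Define $\mathrm{Ob} \in \mathrm{Hom}(A^{\otimes 3}, A)$ and $\mathrm{Ob}_k \in \mathrm{Hom}(A^{\otimes 2}, A)$, $1\le k\le N$, by $$\mathrm{Ob}(a,b,c) = \sum_{p+q=n+1,\ p,q>0} \big( \mu_p(\mu_q(a,b),c) - \mu_p(a,\mu_q(b,c)) \big),$$ $$\mathrm{Ob}_k(a,b) = \sum_{p+q=n+1,\ p,q>0} d_{k,p}(\mu_q(a,b)) - \sum_{i+j=k} \ \sum_{p+q+r=n+1,\ 0\le p,q,r\le n} \mu_p(d_{i,q}(a), d_{j,r}(b)),$$ where $i,j \ge 0$, $d_{0,0} = \mathrm{id}_A$ and $d_{0,q} = 0$ for $q>0$. Then the tuple $(\mathrm{Ob}; \mathrm{Ob}_1, \ldots, \mathrm{Ob}_N)$ is a $3$-cocycle in the cohomology of the AssHDer pair $A$ with coefficients in itself.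
   Context: All vector spaces and linear maps are over a field $\mathbb{K}$ of characteristic zero. Algebras are associative, not assumed unital. Fix an integer $N \ge 1$. A higher derivation of rank $N$ on an associative algebra $A$ is a sequence $\{d_1, \ldots, d_N\}$ of linear maps $A \to A$ with $d_k(ab) = \sum_{i+j=k} d_i(a) d_j(b)$ for $1 \le k \le N$, $a,b\in A$, where $i,j\ge 0$ and $d_0 = \mathrm{id}_A$. An AssHDer pair of rank $N$ is a tuple $(A, d_1, \ldots, d_N)$ of an associative algebra and a higher derivation of rank $N$ on it. Write $\mu$ for the multiplication of $A$. Cohomology with coefficients in itself ($M = A$ with its own multiplication as bimodule actions and $d_k^M = d_k$). For $f \in \mathrm{Hom}(A^{\otimes n}, A)$, $n\ge 1$, $\delta_{\mathrm{Hoch}} f$ is the Hochschild coboundary $(\delta_{\mathrm{Hoch}} f)(a_1, \ldots, a_{n+1}) = a_1 f(a_2, \ldots, a_{n+1}) + \sum_{i=1}^n (-1)^i f(a_1, \ldots, a_i a_{i+1}, \ldots, a_{n+1}) + (-1)^{n+1} f(a_1, \ldots, a_n) a_{n+1}$, and $\delta_k f = \sum_{i_1 + \cdots + i_n = k,\ i_l\ge 0} f \circ (d_{i_1} \otimes \cdots \otimes d_{i_n}) - d_k \circ f$ for $1\le k\le N$. For a tuple $(f_1, \ldots, f_N)$ in $\mathrm{Hom}(A^{\otimes n}, A)$ and $1\le k\le N$, $\delta'_{\mathrm{Hoch}}(f_k)(a_1, \ldots, a_{n+1}) = \sum_{i+j=k,\ i \ge 0,\ j \ge 1} d_i(a_1)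 f_j(a_2, \ldots, a_{n+1}) + \sum_{i=1}^n (-1)^i f_k(a_1, \ldots, a_i a_{i+1}, \ldots, a_{n+1}) + (-1)^{n+1} \sum_{i+j=k,\ i \ge 1,\ j \ge 0} f_i(a_1, \ldots, a_n) d_j(a_{n+1})$. Set $C^0_{\mathrm{AssHDer}}(A,A) = 0$, $C^1_{\mathrm{AssHDer}}(A, A) = \mathrm{Hom}(A, A)$, and $C^n_{\mathrm{AssHDer}}(A, A) = \mathrm{Hom}(A^{\otimes n}, A) \times \mathrm{Hom}(A^{\otimes n-1}, A)^{N}$ for $n \ge 2$. The differential is $\partial f = (\delta_{\mathrm{Hoch}} f; -\delta_1 f, \ldots, -\delta_N f)$ for $f\in C^1$, and $\partial(f; f_1, \ldots, f_N) = (\delta_{\mathrm{Hoch}} f; \delta'_{\mathrm{Hoch}} f_1 + (-1)^n \delta_1 f, \ldots, \delta'_{\mathrm{Hoch}} f_N + (-1)^n \delta_N f)$ for $(f; f_1, \ldots, f_N) \in C^n$, $n \ge 2$. An element of $C^n$ is an $n$-cocycle if $\partial$ of it is zero. A deformation of order $n$ of $(A, d_1, \ldots, d_N)$ consists of sums $\mu_t = \sum_{i=0}^n t^i \mu_i$, $d_{k,t} = \sum_{i=0}^n t^i d_{k,i}$ ($1\le k\le N$), with $\mu_i \in \mathrm{Hom}(A^{\otimes 2}, A)$, $d_{k,i} \in \mathrm{Hom}(A,A)$, $\mu_0 = \mu$, $d_{k,0} = d_k$, such that $(A[[t]]/(t^{n+1}), \mu_t, d_{1,t}, \ldots, d_{N,t})$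 is an AssHDer pair over $\mathbb{K}[[t]]/(t^{n+1})$. *)

(* Defs.v *)
From HB Require Import structures.
From mathcomp Require Import all_boot all_order all_algebra.

Set Implicit Arguments.
Unset Strict Implicit.
Unset Printing Implicit Defensive.

Import GRing.Theory.
Local Open Scope ring_scope.

(* Tuples (x_1, ..., x_N) are families indexed by 'I_N, the index k : 'I_N    *)
(* standing for k.+1. Families that also have a 0-th member, such as          *)
(* (d_0 = id, d_1, ..., d_N), are indexed by 'I_N.+1 without any shift.       *)

Section AssHDerPair.
Variables (R : comNzRingType) (M : lmodType R) (N : nat).

Definition withd0 (d : 'I_N -> {linear M -> M}) (i : 'I_N.+1) :
    {linear M -> M} :=
  if unlift ord0 i is Some k then d k else idfun.

Definition higher_derivation (mu : {bilinear M -> M -> M})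
    (d : 'I_N -> {linear M -> M}) : Prop :=
  forall (k : 'I_N) (a b : M),
    d k (mu a b) = \sum_(i < N.+1) \sum_(j < N.+1 | (i + j == k.+1)%N)
                     mu (withd0 d i a) (withd0 d j b).

Record AssHDer_pair (mu : {bilinear M -> M -> M})
    (d : 'I_N -> {linear M -> M}) : Prop := AssHDerPair {
  AssHDer_assoc : associative mu;
  AssHDer_hder : higher_derivation mu d }.

End AssHDerPair.

(* The complex of an AssHDer pair with coefficients in itself. An element of  *)
(* Hom(A^{(x) n}, A) is a multilinear function on {ffun 'I_n -> A}.           *)

Section Cohomology.
Variables (K : fieldType) (A : lmodType K) (N : nat).
Variables (mu : {bilinear A -> A -> A}) (d : 'I_N -> {linear A -> A}).

Definition nmap (n : nat) : Type := {ffun 'I_n -> A} -> A.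

Definition multilinear (n : nat) (f : nmap n) : Prop :=
  forall (i : 'I_n) (a : {ffun 'I_n -> A}),
    linear (fun x : A => f [ffun j => if j == i then x else a j]).

Section Arguments.
Variables (n : nat) (a : {ffun 'I_n.+1 -> A}).

Definition all_but_first : {ffun 'I_n -> A} :=
  [ffun j : 'I_n => a (lift ord0 j)].

Definition all_but_last : {ffun 'I_n -> A} :=
  [ffun j : 'I_n => a (widen_ord (leqnSn n) j)].

(* the argument list (a_1, ..., a_i a_{i+1}, ..., a_{n+1}), with i shifted to *)
(* start at 0                                                                 *)
Definition contract (i : 'I_n) : {ffun 'I_n -> A} :=
  [ffun j : 'I_n =>
     if (j < i)%N then a (widen_ord (leqnSn n) j)
     else if j == i then mu (a (widen_ord (leqnSn n) j)) (a (lift ord0 j))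
     else a (lift ord0 j)].

End Arguments.

Definition delta_Hoch (n : nat) (f : nmap n) : nmap n.+1 := fun a =>
  mu (a ord0) (f (all_but_first a))
  + \sum_(i < n) (-1) ^+ i.+1 *: f (contract a i)
  + (-1) ^+ n.+1 *: mu (f (all_but_last a)) (a ord_max).

Definition delta (k : 'I_N) (n : nat) (f : nmap n) : nmap n := fun a =>
  \sum_(i : {ffun 'I_n -> 'I_N.+1} | (\sum_(l < n) i l == k.+1)%N)
     f [ffun l => withd0 d (i l) (a l)]
  - d k (f a).

Definition delta'_Hoch (n : nat) (f : 'I_N -> nmap n) (k : 'I_N) : nmap n.+1 :=
  fun a =>
  \sum_(i < N.+1) \sum_(j < N | (i + j.+1 == k.+1)%N)
     mu (withd0 d i (a ord0)) (f j (all_but_first a))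
  + \sum_(i < n) (-1) ^+ i.+1 *: f k (contract a i)
  + (-1) ^+ n.+1 *:
      \sum_(i < N) \sum_(j < N.+1 | (i.+1 + j == k.+1)%N)
         mu (f i (all_but_last a)) (withd0 d j (a ord_max)).

Definition cochain (n : nat) : Type :=
  match n with
  | 0 => unit
  | 1 => nmap 1
  | m.+2 => nmap m.+2 * ('I_N -> nmap m.+1)
  end.

Definition cochain_multilinear (n : nat) : cochain n -> Prop :=
  match n return cochain n -> Prop with
  | 0 => fun _ => True
  | 1 => fun f => multilinear f
  | m.+2 => fun c => multilinear c.1 /\ (forall k, multilinear (c.2 k))
  end.

Definition cochain_zero (n : nat) : cochain n -> Prop :=
  match n return cochain n -> Prop with
  | 0 => fun _ => True
  | 1 => fun f => forall a, f a = 0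
  | m.+2 => fun c => (forall a, c.1 a = 0) /\ (forall k a, c.2 k a = 0)
  end.

Definition coboundary (n : nat) : cochain n -> cochain n.+1 :=
  match n return cochain n -> cochain n.+1 with
  | 0 => fun _ _ => 0
  | 1 => fun f => (delta_Hoch f, fun k a => - delta k f a)
  | m.+2 => fun c =>
      (delta_Hoch c.1,
       fun k a => delta'_Hoch c.2 k a + (-1) ^+ m.+2 *: delta k c.1 a)
  end.

Definition cocycle (n : nat) (c : cochain n) : Prop :=
  cochain_multilinear c /\ cochain_zero (coboundary c).

End Cohomology.

(* K[[t]]/(t^{n+1}) is {poly %/ 'X^n.+1}; an element of A[[t]]/(t^{n+1}) is   *)
(* given by its coefficients x_0, ..., x_n in A.                              *)

Definition trunc_series (K : fieldType) (A : lmodType K) (n : nat) : Type :=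
  {ffun 'I_n.+1 -> A}.

HB.instance Definition _ (K : fieldType) (A : lmodType K) (n : nat) :=
  GRing.Zmodule.copy (trunc_series A n) {ffun 'I_n.+1 -> A}.

Section TruncatedSeries.
Variables (K : fieldType) (A : lmodType K) (n : nat).
Local Notation Kt := {poly %/ ('X^(n.+1) : {poly K})}.
Local Notation At := (trunc_series A n).

Definition ts_scale (c : Kt) (x : At) : At :=
  [ffun m : 'I_n.+1 => \sum_(i < n.+1) \sum_(j < n.+1 | (i + j == m)%N)
     (c : {poly K})`_i *: x j].

(* mu_t = \sum_i t^i mu_i, extended K[[t]]/(t^{n+1})-bilinearly *)
Definition ts_mul (mu_ : 'I_n.+1 -> {bilinear A -> A -> A}) (x y : At) : At :=
  [ffun m : 'I_n.+1 => \sum_(p < n.+1) \sum_(q < n.+1)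
     \sum_(r < n.+1 | (p + q + r == m)%N) mu_ p (x q) (y r)].

(* f_t = \sum_i t^i f_i, extended K[[t]]/(t^{n+1})-linearly *)
Definition ts_map (f_ : 'I_n.+1 -> {linear A -> A}) (x : At) : At :=
  [ffun m : 'I_n.+1 => \sum_(p < n.+1) \sum_(q < n.+1 | (p + q == m)%N)
     f_ p (x q)].

Lemma sum_eq_if (V : zmodType) (m : 'I_n.+1) (a b : nat) (F : V) :
  \sum_(s < n.+1 | (a + s == m)%N) (if (b == s)%N then F else 0) =
  (if (a + b == m)%N then F else 0).
Proof.
case: eqP => [abm|abm].
  have bn : (b < n.+1)%N.
    by rewrite (leq_ltn_trans _ (ltn_ord m)) // -abm leq_addl.
  rewrite (bigD1 (Ordinal bn)) /= ?abm // eqxx big1 ?addr0 // => s /andP[_ sb].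
  by case: eqP => // bs; case/eqP: sb; apply: val_inj; rewrite /= bs.
by rewrite big1 // => s /eqP asm; case: eqP => // bs; case: abm; rewrite bs.
Qed.

Lemma qpoly_coefM (c1 c2 : Kt) (m : 'I_n.+1) :
  ((c1 * c2 : Kt) : {poly K})`_m =
  \sum_(i < n.+1) \sum_(j < n.+1 | (i + j == m)%N)
     (c1 : {poly K})`_i * (c2 : {poly K})`_j.
Proof.
rewrite poly_of_qpolyM; move: (polyn c1) (polyn c2) => p q.
rewrite mk_monic_Xn -Pdiv.RingMonic.take_poly_rmodp coef_take_poly ltn_ord coefM.
rewrite (big_ord_widen _ (fun i => p`_i * q`_(m - i)) (ltn_ord m)).
rewrite big_mkcond /=; apply: eq_bigr => i _; rewrite ltnS; case: leqP => im.
  have mi : (m - i < n.+1)%N by rewrite (leq_ltn_trans (leq_subr _ _)).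
  rewrite (bigD1 (Ordinal mi)) /= ?subnKC // big1 ?addr0 // => j /andP[/eqP ij].
  by case/eqP; apply: val_inj; rewrite /= -ij addKn.
rewrite big1 // => j /eqP ij; suff: (i <= m)%N by rewrite leqNgt im.
by rewrite -ij leq_addr.
Qed.

Fact ts_scaleA (a b : Kt) (v : At) :
  ts_scale a (ts_scale b v) = ts_scale (a * b) v.
Proof.
apply/ffunP => m; rewrite !ffunE.
transitivity (\sum_(i < n.+1) \sum_(k < n.+1) \sum_(l < n.+1)
  if (i + (k + l) == m)%N
  then ((a : {poly K})`_i * (b : {poly K})`_k) *: v l else 0).
  apply: eq_bigr => i _.
  transitivity (\sum_(j < n.+1 | (i + j == m)%N) \sum_(k < n.+1) \sum_(l < n.+1)
    if (k + l == j)%N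
    then ((a : {poly K})`_i * (b : {poly K})`_k) *: v l else 0).
    apply: eq_bigr => j _; rewrite ffunE scaler_sumr; apply: eq_bigr => k _.
    rewrite scaler_sumr big_mkcond /=; apply: eq_bigr => l _.
    by case: eqP => //; rewrite scalerA.
  rewrite exchange_big /=; apply: eq_bigr => k _.
  by rewrite exchange_big /=; apply: eq_bigr => l _; rewrite sum_eq_if.
transitivity (\sum_(l < n.+1) \sum_(j < n.+1 | (l + j == m)%N)
  (((a * b : Kt) : {poly K})`_j *: v l)); last first.
  rewrite (exchange_big_dep xpredT) //=; apply: eq_bigr => j _.
  by apply: eq_bigl => l; rewrite addnC.
transitivity (\sum_(l < n.+1) \sum_(i < n.+1) \sum_(k < n.+1)
  if (i + (k + l) == m)%N
  then ((a : {poly K})`_i * (b : {poly K})`_k) *: v l else 0).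
  rewrite [RHS]exchange_big /=; apply: eq_bigr => i _.
  exact: exchange_big.
apply: eq_bigr => l _.
transitivity (\sum_(j < n.+1 | (l + j == m)%N) \sum_(i < n.+1) \sum_(k < n.+1)
    if (i + k == j)%N
    then ((a : {poly K})`_i * (b : {poly K})`_k) *: v l else 0).
  rewrite [RHS]exchange_big /=; apply: eq_bigr => i _.
  rewrite [RHS]exchange_big /=; apply: eq_bigr => k _; rewrite sum_eq_if.
  by rewrite [(l + _)%N]addnC addnA.
apply: eq_bigr => j _; rewrite qpoly_coefM scaler_suml; apply: eq_bigr => i _.
rewrite scaler_suml [RHS]big_mkcond /=; apply: eq_bigr => k _.
by case: eqP.
Qed.

Fact ts_scale1 : left_id 1 ts_scale.
Proof.
move=> v; apply/ffunP => m; rewrite ffunE big_ord_recl [X in _ + X]big1 => [|i _].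
  rewrite addr0 (bigD1 m) //= big1 ?addr0 ?coefC ?scale1r // => j.
  by case/andP=> /eqP jm /eqP[]; apply: val_inj.
by rewrite big1 // => j _; rewrite coefC /= scale0r.
Qed.

Fact ts_scaleDr : right_distributive ts_scale +%R.
Proof.
move=> c x y; apply/ffunP => m; rewrite !ffunE -big_split /=.
apply: eq_bigr => i _; rewrite -big_split /=.
by apply: eq_bigr => j _; rewrite ffunE scalerDr.
Qed.

Fact ts_scaleDl (v : At) : {morph ts_scale^~ v : a b / a + b}.
Proof.
move=> a b; apply/ffunP => m; rewrite !ffunE -big_split /=.
apply: eq_bigr => i _; rewrite -big_split /=.
by apply: eq_bigr => j _; rewrite coefD scalerDl.
Qed.

HB.instance Definition _ := GRing.Zmodule_isLmodule.Build Kt At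
  ts_scaleA ts_scale1 ts_scaleDr ts_scaleDl.

Lemma ts_scaleE (c : Kt) (x : At) : c *: x = ts_scale c x.
Proof. by []. Qed.

Section Linear.
Variable f_ : 'I_n.+1 -> {linear A -> A}.

Fact ts_map_is_linear : linear (ts_map f_).
Proof.
move=> c x y; apply/ffunP => m; rewrite ts_scaleE !ffunE.
transitivity (\sum_(p < n.+1) \sum_(q < n.+1 | (p + q == m)%N)
   (f_ p (ts_scale c x q) + f_ p (y q))).
  by apply: eq_bigr => p _; apply: eq_bigr => q _; rewrite ffunE linearD.
under eq_bigr do rewrite big_split; rewrite big_split /=; congr (_ + _).
transitivity (\sum_(p < n.+1) \sum_(i < n.+1) \sum_(j < n.+1)
  if (p + (i + j) == m)%N then (c : {poly K})`_i *: f_ p (x j) else 0).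
  apply: eq_bigr => p _.
  transitivity (\sum_(q < n.+1 | (p + q == m)%N) \sum_(i < n.+1) \sum_(j < n.+1)
    if (i + j == q)%N then (c : {poly K})`_i *: f_ p (x j) else 0).
    apply: eq_bigr => q _; rewrite ffunE linear_sum; apply: eq_bigr => i _.
    rewrite linear_sum big_mkcond /=; apply: eq_bigr => j _.
    by case: eqP => //; rewrite linearZ.
  rewrite exchange_big /=; apply: eq_bigr => i _.
  by rewrite exchange_big /=; apply: eq_bigr => j _; rewrite sum_eq_if.
rewrite exchange_big /=; apply: eq_bigr => i _.
transitivity (\sum_(q < n.+1 | (i + q == m)%N) \sum_(p < n.+1) \sum_(j < n.+1)
    if (p + j == q)%N then (c : {poly K})`_i *: f_ p (x j) else 0).
  rewrite [RHS]exchange_big /=; apply: eq_bigr => p _.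
  rewrite [RHS]exchange_big /=; apply: eq_bigr => j _; rewrite sum_eq_if.
  by rewrite addnCA.
apply: eq_bigr => q _; rewrite ffunE scaler_sumr; apply: eq_bigr => p _.
rewrite scaler_sumr [RHS]big_mkcond /=; apply: eq_bigr => j _.
by case: eqP.
Qed.

HB.instance Definition _ := GRing.isSemilinear.Build Kt At At _ (ts_map f_)
  (GRing.semilinear_linear ts_map_is_linear).

End Linear.

Section Bilinear.
Variable mu_ : 'I_n.+1 -> {bilinear A -> A -> A}.

Definition ts_mull (x : At) (s : 'I_n.+1) (b : A) : A :=
  \sum_(p < n.+1) \sum_(q < n.+1 | (p + q == s)%N) mu_ p (x q) b.

Definition ts_mulr (y : At) (s : 'I_n.+1) (a : A) : A :=
  \sum_(p < n.+1) \sum_(r < n.+1 | (p + r == s)%N) mu_ p a (y r).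

Fact ts_mull_is_linear x s : linear (ts_mull x s).
Proof.
move=> c a b; rewrite /ts_mull scaler_sumr -big_split /=.
apply: eq_bigr => p _; rewrite scaler_sumr -big_split /=.
by apply: eq_bigr => q _; rewrite linearPr.
Qed.

Fact ts_mulr_is_linear y s : linear (ts_mulr y s).
Proof.
move=> c a b; rewrite /ts_mulr scaler_sumr -big_split /=.
apply: eq_bigr => p _; rewrite scaler_sumr -big_split /=.
by apply: eq_bigr => q _; rewrite linearPl.
Qed.

HB.instance Definition _ x s := GRing.isSemilinear.Build K A A _ (ts_mull x s)
  (GRing.semilinear_linear (ts_mull_is_linear x s)).
HB.instance Definition _ y s := GRing.isSemilinear.Build K A A _ (ts_mulr y s)
  (GRing.semilinear_linear (ts_mulr_is_linear y s)).

Lemma ts_mulEl x y : ts_mul mu_ x y = ts_map (ts_mull x) y.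
Proof.
apply/ffunP => m; rewrite !ffunE.
transitivity (\sum_(r < n.+1) \sum_(p < n.+1) \sum_(q < n.+1)
  if (r + (p + q) == m)%N then mu_ p (x q) (y r) else 0).
  rewrite [RHS]exchange_big /=; apply: eq_bigr => p _.
  rewrite [RHS]exchange_big /=; apply: eq_bigr => q _.
  by rewrite big_mkcond /=; apply: eq_bigr => r _; rewrite addnC.
rewrite [RHS](exchange_big_dep xpredT) //=; apply: eq_bigr => r _.
under [RHS]eq_bigl do rewrite addnC.
transitivity (\sum_(s < n.+1 | (r + s == m)%N) \sum_(p < n.+1) \sum_(q < n.+1)
  if (p + q == s)%N then mu_ p (x q) (y r) else 0); last first.
  by apply: eq_bigr => s _; apply: eq_bigr => p _; rewrite [RHS]big_mkcond.
rewrite [RHS]exchange_big /=; apply: eq_bigr => p _.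
by rewrite [RHS]exchange_big /=; apply: eq_bigr => q _; rewrite sum_eq_if.
Qed.

Lemma ts_mulEr x y : ts_mul mu_ x y = ts_map (ts_mulr y) x.
Proof.
apply/ffunP => m; rewrite !ffunE.
transitivity (\sum_(q < n.+1) \sum_(p < n.+1) \sum_(r < n.+1)
  if (q + (p + r) == m)%N then mu_ p (x q) (y r) else 0).
  rewrite [RHS]exchange_big /=; apply: eq_bigr => q _.
  apply: eq_bigr => p _; rewrite big_mkcond /=; apply: eq_bigr => r _.
  by rewrite addnCA addnA.
rewrite [RHS](exchange_big_dep xpredT) //=; apply: eq_bigr => q _.
under [RHS]eq_bigl do rewrite addnC.
transitivity (\sum_(s < n.+1 | (q + s == m)%N) \sum_(p < n.+1) \sum_(r < n.+1)
  if (p + r == s)%N then mu_ p (x q) (y r) else 0); last first.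
  by apply: eq_bigr => s _; apply: eq_bigr => p _; rewrite [RHS]big_mkcond.
rewrite [RHS]exchange_big /=; apply: eq_bigr => p _.
by rewrite [RHS]exchange_big /=; apply: eq_bigr => r _; rewrite sum_eq_if.
Qed.

Fact ts_mul_is_bilinear : bilinear_for *:%R *:%R (ts_mul mu_).
Proof.
split=> [y c x1 x2|x c y1 y2].
  by rewrite !ts_mulEr linearP.
by rewrite !ts_mulEl linearP.
Qed.

HB.instance Definition _ := bilinear_isBilinear.Build Kt At At At _ _
  (ts_mul mu_) ts_mul_is_bilinear.

End Bilinear.

End TruncatedSeries.

Section Deformation.
Variables (K : fieldType) (A : lmodType K) (N n : nat).

Record deformation (mu : {bilinear A -> A -> A}) (d : 'I_N -> {linear A -> A})
    (mu_ : 'I_n.+1 -> {bilinear A -> A -> A})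
    (d_ : 'I_N -> 'I_n.+1 -> {linear A -> A}) : Prop := Deformation {
  deformation_mu0 : mu_ ord0 =2 mu;
  deformation_d0 : forall k, d_ k ord0 =1 d k;
  deformation_pair :
    @AssHDer_pair {poly %/ ('X^(n.+1) : {poly K})} (trunc_series A n) N
      (ts_mul mu_) (fun k => ts_map (d_ k)) }.

Variables (mu_ : 'I_n.+1 -> {bilinear A -> A -> A}).
Variables (d_ : 'I_N -> 'I_n.+1 -> {linear A -> A}).

Definition withd0_coef (i : 'I_N.+1) (q : 'I_n.+1) : {linear A -> A} :=
  if unlift ord0 i is Some k then d_ k q
  else if q == ord0 then (idfun : {linear A -> A}) else (\0 : {linear A -> A}).

Definition Ob3 (a b c : A) : A :=
  \sum_(p < n.+1) \sum_(q < n.+1 | [&& (p + q == n.+1)%N, (0 < p)%N & (0 < q)%N])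
     (mu_ p (mu_ q a b) c - mu_ p a (mu_ q b c)).

Definition Obk2 (k : 'I_N) (a b : A) : A :=
  \sum_(p < n.+1) \sum_(q < n.+1 | [&& (p + q == n.+1)%N, (0 < p)%N & (0 < q)%N])
     d_ k p (mu_ q a b)
  - \sum_(i < N.+1) \sum_(j < N.+1 | (i + j == k.+1)%N)
      \sum_(p < n.+1) \sum_(q < n.+1) \sum_(r < n.+1 | (p + q + r == n.+1)%N)
        mu_ p (withd0_coef i q a) (withd0_coef j r b).

Definition Ob : nmap A 3 := fun v => Ob3 (v ord0) (v (inord 1)) (v (inord 2)).

Definition Obk (k : 'I_N) : nmap A 2 := fun v => Obk2 k (v ord0) (v (inord 1)).

End Deformation.

(* Main.v *)
Require Import Defs.
From HB Require Import structures.
From mathcomp Require Import all_boot all_order all_algebra.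

(* Extend mu_t and d_{k,t} by zero to the coefficient of t^{n+1} and work over *)
(* K[[t]]/(t^{n+2}). There the associator of mu_t and the Leibniz defect of    *)
(* d_{k,t} vanish modulo t^{n+1}, and their coefficients at t^{n+1} are Ob and *)
(* Ob_k applied to constant terms. Any bilinear product satisfies the pentagon *)
(* identity for its associator, and d_k(associator) minus the associators of   *)
(* the derivatives is a combination of Leibniz defects; the coefficients of    *)
(* these two identities at t^{n+1} are the two components of the cocycle       *)
(* condition.                                                                  *)

Import GRing.Theory.
Local Open Scope ring_scope.

(** [Ob] and [Obk] measure how far the extension of the deformation by zero coefficients at t^{n+1}
    is from being an AssHDer pair over K[[t]]/(t^{n+2}). Its associator and Leibniz defects truncate
    to those of the given deformation, hence take values in t^{n+1} A. Since t kills t^{n+1} A, a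
    multilinear map with such values sees only the constant terms of its arguments
    ([linear_top_valued]); so the top coefficients of the defects are [Ob3] and [Obk2] of constant
    terms for all series ([associator_max], [leibniz_max]).

    The cocycle condition is then the top coefficient of two formal identities, valid for any
    bilinear product and any linear maps: [associator_pentagon] and [leibniz_defect_associator]. In
    that coefficient an operation applied to a defect contributes only its constant term [mu] or
    [d]. This yields [Ob3_cocycle] and [Obk2_cocycle], and the theorem matches them with the signs
    and argument lists of [coboundary]. *)

Section LinearClosure.
Set Implicit Arguments.
Variables (R : nzRingType) (U V W : lmodType R).

Lemma linear_comp_fun (g : {linear V -> W}) (f : U -> V) :
  linear f -> linear (fun x => g (f x)).
Proof. by move=> lf c x y; rewrite lf linearP. Qed.

Lemma linear_sub_fun (f g : U -> V) :
  linear f -> linear g -> linear (fun x => f x - g x).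
Proof.
by move=> lf lg c x y; rewrite lf lg opprD addrACA scalerBr.
Qed.

Lemma linear_sum_fun (I : Type) (r : seq I) (P : pred I) (f : I -> U -> V) :
  (forall i, linear (f i)) -> linear (fun x => \sum_(i <- r | P i) f i x).
Proof.
move=> lf c x y; rewrite scaler_sumr -big_split.
by apply: eq_bigr => i _; apply: lf.
Qed.

End LinearClosure.

Section BilinearClosure.
Set Implicit Arguments.
Variables (R : comNzRingType) (U V W Z : lmodType R).
Variable mu : {bilinear U -> V -> W}.

Lemma linear_bilinearl (f : Z -> U) v :
  linear f -> linear (fun x => mu (f x) v).
Proof. by move=> lf c x y; rewrite lf linearPl. Qed.

Lemma linear_bilinearr (f : Z -> V) u :
  linear f -> linear (fun x => mu u (f x)).
Proof. by move=> lf c x y; rewrite lf linearPr. Qed.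

End BilinearClosure.

(** Here s is determined as i + j, and it stays in range because i + j <= m <= n. *)
Lemma exchange_convol {V : zmodType} {n : nat} (m : 'I_n.+1)
    (F : 'I_n.+1 -> 'I_n.+1 -> 'I_n.+1 -> V) :
  \sum_(s < n.+1) \sum_(k < n.+1 | (s + k == m)%N)
     \sum_(i < n.+1) \sum_(j < n.+1 | (i + j == s)%N) F i j k =
  \sum_(i < n.+1) \sum_(j < n.+1) \sum_(k < n.+1 | (i + j + k == m)%N) F i j k.
Proof.
transitivity (\sum_(k < n.+1) \sum_(s < n.+1 | (k + s == m)%N)
    \sum_(i < n.+1) \sum_(j < n.+1) if (i + j == s)%N then F i j k else 0).
  rewrite (exchange_big_dep xpredT) //=; apply: eq_bigr => k _.
  apply: eq_big => [s|s _]; first by rewrite addnC.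
  by apply: eq_bigr => i _; rewrite big_mkcond.
transitivity (\sum_(k < n.+1) \sum_(i < n.+1) \sum_(j < n.+1)
    if (i + j + k == m)%N then F i j k else 0).
  apply: eq_bigr => k _; rewrite exchange_big; apply: eq_bigr => i _.
  by rewrite exchange_big; apply: eq_bigr => j _; rewrite sum_eq_if addnC.
rewrite exchange_big; apply: eq_bigr => i _.
by rewrite exchange_big; apply: eq_bigr => j _; rewrite -big_mkcond.
Qed.

(** Turns the sum over index tuples in [delta], for three arguments, into the triple sum of
    [Obk2_cocycle]. *)
Lemma sum_ffun3 {V : nmodType} {I : finType} (P : pred {ffun 'I_3 -> I})
    (F : {ffun 'I_3 -> I} -> V) :
  let t i j k := [ffun l : 'I_3 => nth i [:: i; j; k] l] in
  \sum_(f | P f) F f =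
  \sum_(i : I) \sum_(j : I) \sum_(k : I | P (t i j k)) F (t i j k).
Proof.
move=> t; rewrite pair_big_dep pair_big_dep /=.
rewrite (reindex (fun p : I * I * I => t p.1.1 p.1.2 p.2)) //=.
exists (fun f : {ffun 'I_3 -> I} => (f ord0, f (inord 1), f (inord 2))).
  by case=> [[i j] k] _; rewrite !ffunE !inordK.
move=> f _; apply/ffunP => l; rewrite ffunE /=.
case: l => [[|[|[|l]]] ltl] //=; congr (f _); apply: val_inj => //=;
  by rewrite inordK.
Qed.

(** * Formal identities between associators and Leibniz defects *)

Section Defects.
Set Implicit Arguments.
Variables (R : comNzRingType) (M : lmodType R) (N : nat).
Variables (mu : {bilinear M -> M -> M}) (d : 'I_N -> {linear M -> M}).

Definition associator (x y z : M) : M := mu (mu x y) z - mu x (mu y z).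

Definition leibniz_defect (k : 'I_N) (x y : M) : M :=
  d k (mu x y) - \sum_(i < N.+1) \sum_(j < N.+1 | (i + j == k.+1)%N)
                    mu (withd0 d i x) (withd0 d j y).

Lemma associator_linear1 y z : linear (fun x => associator x y z).
Proof.
apply: linear_sub_fun; apply: linear_bilinearl => //.
exact: linear_bilinearl.
Qed.

Lemma associator_linear2 x z : linear (fun y => associator x y z).
Proof.
apply: linear_sub_fun; first exact/linear_bilinearl/linear_bilinearr.
exact/linear_bilinearr/linear_bilinearl.
Qed.

Lemma associator_linear3 x y : linear (associator x y).
Proof.
apply: linear_sub_fun; apply: linear_bilinearr => //.
exact: linear_bilinearr.
Qed.

Lemma withd0_linear i : linear (withd0 d i).
Proof. by move=> c x y; rewrite linearP. Qed.

Lemma leibniz_defect_linear1 k y : linear (fun x => leibniz_defect k x y).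
Proof.
apply: linear_sub_fun; first exact/linear_comp_fun/linear_bilinearl.
apply: linear_sum_fun => i; apply: linear_sum_fun => j.
exact/linear_bilinearl/withd0_linear.
Qed.

Lemma leibniz_defect_linear2 k x : linear (leibniz_defect k x).
Proof.
apply: linear_sub_fun; first exact/linear_comp_fun/linear_bilinearr.
apply: linear_sum_fun => i; apply: linear_sum_fun => j.
exact/linear_bilinearr/withd0_linear.
Qed.

Lemma withd0_0 x : withd0 d ord0 x = x.
Proof. by rewrite /withd0 unlift_none. Qed.

Lemma withd0_lift k : withd0 d (lift ord0 k) = d k.
Proof. by rewrite /withd0 liftK. Qed.

(** Each of the five terms expands into two bracketings of xyzw; each of the five bracketings then
    occurs twice, with opposite signs. *)
Lemma associator_pentagon x y z w :
  mu x (associator y z w) - associator (mu x y) z w + associator x (mu y z) w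
  - associator x y (mu z w) + mu (associator x y z) w = 0.
Proof.
rewrite /associator linearBr linearBl !opprB.
rewrite [LHS](ACl (1*4*2*5*3))%AC /=.
by rewrite !addrA !subrK subrr.
Qed.

(** The value 0 at index 0 reflects that the identity obeys its Leibniz rule exactly, so
    [withd0_mul] holds uniformly in i. *)
Let defect0 (i : 'I_N.+1) (x y : M) : M :=
  if unlift ord0 i is Some k then leibniz_defect k x y else 0.

Let withd0_mul i x y :
  withd0 d i (mu x y) = defect0 i x y +
    \sum_(i1 < N.+1) \sum_(i2 < N.+1 | (i1 + i2 == i)%N)
       mu (withd0 d i1 x) (withd0 d i2 y).
Proof.
rewrite /defect0; case: unliftP => [k|] -> /=.
  by rewrite withd0_lift /leibniz_defect subrK.
rewrite add0r withd0_0 (bigD1 ord0) //= (bigD1 ord0) //= !withd0_0.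
rewrite big1 => [|j /andP[/eqP j0 /eqP[]]]; last exact: val_inj.
rewrite addr0 big1 ?addr0 // => i0 i0n0; rewrite big1 // => j.
by rewrite addn_eq0 => /andP[/eqP i00 _]; case/eqP: i0n0; apply: val_inj.
Qed.

(** Expand the inner derivative by [withd0_mul]. Index 0 has no defect, so the defect sum runs over
    positive indices, shifted into 'I_N. *)
Let sum_withd0_mull (k : 'I_N) x y z :
  \sum_(i < N.+1) \sum_(j < N.+1 | (i + j == k.+1)%N)
     mu (withd0 d i (mu x y)) (withd0 d j z) =
  \sum_(i < N) \sum_(j < N.+1 | (i.+1 + j == k.+1)%N)
     mu (leibniz_defect i x y) (withd0 d j z) +
  \sum_(i < N.+1) \sum_(j < N.+1) \sum_(l < N.+1 | (i + j + l == k.+1)%N)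
     mu (mu (withd0 d i x) (withd0 d j y)) (withd0 d l z).
Proof.
pose F i j l := mu (mu (withd0 d i x) (withd0 d j y)) (withd0 d l z).
rewrite -(exchange_convol (lift ord0 k) F) /F.
transitivity (\sum_(i < N.+1) (\sum_(j < N.+1 | (i + j == k.+1)%N)
      mu (defect0 i x y) (withd0 d j z) +
    \sum_(j < N.+1 | (i + j == k.+1)%N) \sum_(i1 < N.+1)
      \sum_(i2 < N.+1 | (i1 + i2 == i)%N)
        mu (mu (withd0 d i1 x) (withd0 d i2 y)) (withd0 d j z))).
  apply: eq_bigr => i _; rewrite -big_split; apply: eq_bigr => j _ /=.
  rewrite withd0_mul linearDl; congr (_ + _).
  rewrite linear_sumlz; apply: eq_bigr => i1 _; exact: linear_sumlz.
rewrite big_split; congr (_ + _); rewrite big_ord_recl /= big1 ?add0r.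
  by apply: eq_bigr => i _; apply: eq_bigr => j _; rewrite /defect0 liftK.
by move=> j _; rewrite /defect0 unlift_none linear0l.
Qed.

Let sum_withd0_mulr (k : 'I_N) x y z :
  \sum_(i < N.+1) \sum_(j < N.+1 | (i + j == k.+1)%N)
     mu (withd0 d i x) (withd0 d j (mu y z)) =
  \sum_(i < N.+1) \sum_(j < N | (i + j.+1 == k.+1)%N)
     mu (withd0 d i x) (leibniz_defect j y z) +
  \sum_(i < N.+1) \sum_(j < N.+1) \sum_(l < N.+1 | (i + j + l == k.+1)%N)
     mu (withd0 d i x) (mu (withd0 d j y) (withd0 d l z)).
Proof.
rewrite -big_split; apply: eq_bigr => i _ /=.
transitivity (\sum_(j < N.+1 | (i + j == k.+1)%N)
      mu (withd0 d i x) (defect0 j y z) +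
    \sum_(j < N.+1 | (i + j == k.+1)%N) \sum_(i1 < N.+1)
      \sum_(i2 < N.+1) if (i1 + i2 == j)%N then
        mu (withd0 d i x) (mu (withd0 d i1 y) (withd0 d i2 z)) else 0).
  rewrite -big_split; apply: eq_bigr => j _ /=.
  rewrite withd0_mul linearDr; congr (_ + _).
  rewrite linear_sumr; apply: eq_bigr => i1 _.
  by rewrite linear_sumr big_mkcond.
congr (_ + _).
  rewrite big_mkcond big_ord_recl /= /defect0 unlift_none linear0r.
  rewrite if_same add0r.
  rewrite [RHS]big_mkcond.
  by apply: eq_bigr => j _; rewrite liftK.
rewrite exchange_big; apply: eq_bigr => j _.
rewrite exchange_big [RHS]big_mkcond; apply: eq_bigr => l _.
by rewrite (sum_eq_if (lift ord0 k)) addnA.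
Qed.

(** Apply the Leibniz rule with defect twice to each of (xy)z and x(yz). The defect-free parts
    combine into associators of derivatives, and only the four defect terms remain. *)
Lemma leibniz_defect_associator (k : 'I_N) x y z :
  d k (associator x y z)
  - \sum_(i < N.+1) \sum_(j < N.+1) \sum_(l < N.+1 | (i + j + l == k.+1)%N)
      associator (withd0 d i x) (withd0 d j y) (withd0 d l z) =
  leibniz_defect k (mu x y) z
  + \sum_(i < N) \sum_(j < N.+1 | (i.+1 + j == k.+1)%N)
      mu (leibniz_defect i x y) (withd0 d j z)
  - leibniz_defect k x (mu y z)
  - \sum_(i < N.+1) \sum_(j < N | (i + j.+1 == k.+1)%N)
      mu (withd0 d i x) (leibniz_defect j y z).
Proof.
rewrite /associator.
under eq_bigr do under eq_bigr do rewrite sumrB.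
under eq_bigr do rewrite sumrB.
rewrite sumrB linearB {1 3}/leibniz_defect sum_withd0_mull sum_withd0_mulr.
rewrite !opprB opprD (addrC (- _) (- _)) !addrA subrK.
by rewrite [RHS](ACl (1*5*4*2*3*6))%AC /= addrK.
Qed.

End Defects.

(** * Convolution sums with a single surviving term *)

Section Convolution.
Set Implicit Arguments.
Variables (V : nmodType) (n : nat) (F : 'I_n.+1 -> 'I_n.+1 -> V).

Lemma convol_at0 : \sum_(p < n.+1) \sum_(q < n.+1 | (p + q == 0)%N) F p q =
  F ord0 ord0.
Proof.
rewrite big_ord_recl [X in _ + X]big1 ?addr0; last first.
  by move=> p _; rewrite big1.
rewrite (bigD1 ord0) //= big1 ?addr0 // => q /andP[/eqP q0 /eqP[]].
exact: val_inj.
Qed.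

Lemma convol_at_max : (forall p q, q != ord_max -> F p q = 0) ->
  \sum_(p < n.+1) \sum_(q < n.+1 | (p + q == n)%N) F p q = F ord0 ord_max.
Proof.
move=> F0; rewrite big_ord_recl [X in _ + X]big1 ?addr0; last first.
  move=> p _; apply: big1 => q /eqP pq; apply: F0.
  apply/eqP => qmax; move: (leq_addl p n).
  by rewrite -[X in (X <= _)%N]pq qmax lift0 addSn ltnn.
by rewrite (bigD1 ord_max) //= big1 ?addr0 // => q /andP[_ /F0].
Qed.

Lemma convol_with0 (m : 'I_n.+1) : (forall p q, q != ord0 -> F p q = 0) ->
  \sum_(p < n.+1) \sum_(q < n.+1 | (p + q == m)%N) F p q = F m ord0.
Proof.
move=> F0; rewrite (bigD1 m) //= [X in _ + X]big1 ?addr0 => [|p pm].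
  rewrite (bigD1 ord0) ?addn0 //= big1 ?addr0 // => q /andP[_].
  exact: F0.
apply: big1 => q /eqP pq; apply: F0; apply/eqP => q0.
by case/eqP: pm; apply: val_inj; rewrite /= -pq q0 addn0.
Qed.

End Convolution.

(** * Coefficients of products and maps on truncated series *)

Section TruncatedSeriesCoefficients.
Set Implicit Arguments.
Variables (K : fieldType) (A : lmodType K) (n : nat).
Local Notation At := (trunc_series A n).

Definition ts_const (a : A) : At := [ffun m => if m == ord0 then a else 0].

(** The submodule t^n A, which is annihilated by t. *)
Definition top_only (z : At) : Prop := forall m, m != ord_max -> z m = 0.

Lemma ts_coefD (x y : At) m : (x + y) m = x m + y m.
Proof. by rewrite ffunE. Qed.

Lemma ts_coefN (x : At) m : (- x) m = - x m.
Proof. by rewrite ffunE. Qed.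

Lemma ts_coefB (x y : At) m : (x - y) m = x m - y m.
Proof. by rewrite ts_coefD ts_coefN. Qed.

Lemma ts_coef_sum (I : Type) (r : seq I) (P : pred I) (x : I -> At) m :
  (\sum_(i <- r | P i) x i) m = \sum_(i <- r | P i) x i m.
Proof. by apply: (big_morph (fun z : At => z m)) => [y z|]; rewrite ffunE. Qed.

Section Map.
Variable f_ : 'I_n.+1 -> {linear A -> A}.

Lemma ts_map_at0 x : ts_map f_ x ord0 = f_ ord0 (x ord0).
Proof. by rewrite ffunE convol_at0. Qed.

Lemma ts_map_top z :
  top_only z -> ts_map f_ z ord_max = f_ ord0 (z ord_max).
Proof.
by move=> ztop; rewrite ffunE convol_at_max // => p q /ztop ->; rewrite linear0.
Qed.

Lemma ts_map_const a m : ts_map f_ (ts_const a) m = f_ m a.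
Proof.
rewrite ffunE convol_with0 => [|p q q0]; first by rewrite ffunE eqxx.
by rewrite ffunE (negPf q0) linear0.
Qed.

End Map.

Section Mul.
Variable mu_ : 'I_n.+1 -> {bilinear A -> A -> A}.

Lemma ts_mul_at0 x y : ts_mul mu_ x y ord0 = mu_ ord0 (x ord0) (y ord0).
Proof. by rewrite ts_mulEl ts_map_at0 /= /ts_mull convol_at0. Qed.

(** A factor in t^n A leaves room only for the constant terms of the product and of the other
    factor. *)
Lemma ts_mul_topr x z :
  top_only z -> ts_mul mu_ x z ord_max = mu_ ord0 (x ord0) (z ord_max).
Proof. by move=> ?; rewrite ts_mulEl ts_map_top //= /ts_mull convol_at0. Qed.

Lemma ts_mul_topl z y :
  top_only z -> ts_mul mu_ z y ord_max = mu_ ord0 (z ord_max) (y ord0).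
Proof. by move=> ?; rewrite ts_mulEr ts_map_top //= /ts_mulr convol_at0. Qed.

Lemma ts_mul_constl a y m : ts_mul mu_ (ts_const a) y m =
  \sum_(p < n.+1) \sum_(q < n.+1 | (p + q == m)%N) mu_ p a (y q).
Proof. by rewrite ts_mulEr ts_map_const. Qed.

Lemma ts_mul_constr x b m : ts_mul mu_ x (ts_const b) m =
  \sum_(p < n.+1) \sum_(q < n.+1 | (p + q == m)%N) mu_ p (x q) b.
Proof. by rewrite ts_mulEl ts_map_const. Qed.

Lemma ts_mul_const a b m :
  ts_mul mu_ (ts_const a) (ts_const b) m = mu_ m a b.
Proof.
rewrite ts_mul_constl convol_with0 => [|p q q0]; first by rewrite ffunE eqxx.
by rewrite ffunE (negPf q0) linear0.
Qed.

End Mul.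

End TruncatedSeriesCoefficients.
Arguments ts_const {K A n} a.

Section TopValued.
Set Implicit Arguments.
Variables (K : fieldType) (A : lmodType K) (n : nat).
Local Notation At := (trunc_series A n.+1).

(* Write x = c + t x', with c constant: F (t x') = t F x' vanishes, because  *)
(* F x' is a multiple of t^{n+1}.                                             *)
Lemma linear_top_valued (F : At -> At) (x : At) :
  linear F -> (forall y, top_only (F y)) -> F x = F (ts_const (x ord0)).
Proof.
move=> linF topF.
pose t : {poly %/ ('X^(n.+2) : {poly K})} := in_qpoly _ 'X.
have tE (i : nat) : (t : {poly K})`_i = (i == 1%N)%:R.
  by rewrite in_qpoly_small ?coefX // mk_monic_Xn size_polyX size_polyXn.
(* The coefficients of x shift down by one; at the top index [m.+1] is out of range and the default
   0 is used. *)
pose x' : At := [ffun m : 'I_n.+2 => oapp x 0 (insub m.+1 : option 'I_n.+2)].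
have xE : x = t *: x' + ts_const (x ord0).
  apply/ffunP => m; rewrite ts_scaleE !ffunE (bigD1 (lift ord0 ord0)) //=.
  rewrite [X in _ + X + _]big1 ?addr0 => [|i i1]; last first.
    apply: big1 => j _; rewrite tE [_ == _ :> nat](_ : _ = false) ?scale0r //.
    by apply: contraNF i1 => /eqP ?; apply/eqP/val_inj.
  case: (unliftP ord0 m) => [k|] -> /=; last by rewrite big_pred0 ?add0r.
  rewrite addr0 (big_pred1 (widen_ord (leqnSn _) k)) => [|j /=]; last first.
    by rewrite eqSS.
  rewrite tE scale1r ffunE insubT => [|ltk /=]; first exact: ltn_ord k.
  by congr (x _); apply: val_inj.
have tF y : top_only y -> t *: y = 0.
  move=> topy; apply/ffunP => m; rewrite ts_scaleE !ffunE.
  apply: big1 => i _; apply: big1 => j /eqP ij; rewrite tE.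
  case: eqP => [i1|]; last by rewrite scale0r.
  rewrite topy ?scaler0 //; apply: contraTneq (leq_ord m) => jmax.
  by rewrite -ij i1 jmax ltnn.
by rewrite {1}xE linF tF ?add0r.
Qed.

End TopValued.

(** * Extension by zero to order n+1 and truncation back to order n *)

Section DropMax.
Set Implicit Arguments.
Variables (V : nmodType) (n : nat).
Local Notation widen := (widen_ord (leqnSn n.+1)).

Lemma big_drop_max (P : pred 'I_n.+2) (F : 'I_n.+2 -> V) :
  (P ord_max -> F ord_max = 0) ->
  \sum_(p < n.+2 | P p) F p = \sum_(p < n.+1 | P (widen p)) F (widen p).
Proof.
move=> F0; rewrite big_mkcond big_ord_recr /= -big_mkcond /=.
by case: ifP => [/F0 ->|]; rewrite addr0.
Qed.

(** Once index n+1 is dropped, p + q = n+1 with p, q <= n forces both to be positive: this is the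
    source of the side conditions in [Ob3] and [Obk2]. *)
Lemma convol_drop_max (F : 'I_n.+2 -> 'I_n.+2 -> V) :
  (forall q, F ord_max q = 0) -> (forall p, F p ord_max = 0) ->
  \sum_(p < n.+2) \sum_(q < n.+2 | (p + q == n.+1)%N) F p q =
  \sum_(p < n.+1)
     \sum_(q < n.+1 | [&& (p + q == n.+1)%N, (0 < p)%N & (0 < q)%N])
       F (widen p) (widen q).
Proof.
move=> F0l F0r; rewrite big_drop_max => [|_]; last by apply: big1.
apply: eq_bigr => p _; rewrite big_drop_max //; apply: eq_bigl => q /=.
case: eqP => //= pq; symmetry; apply/andP; split; rewrite lt0n; apply/eqP => e.
  by move: pq (ltn_ord q); rewrite e add0n => ->; rewrite ltnn.
by move: pq (ltn_ord p); rewrite e addn0 => ->; rewrite ltnn.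
Qed.

End DropMax.

Section ExtensionByZero.
Set Implicit Arguments.
Variables (K : fieldType) (A : lmodType K) (n : nat).
Local Notation widen := (widen_ord (leqnSn n.+1)).
Local Notation At := (trunc_series A n.+1).

Definition bilinear0 : A -> A -> A := fun _ _ => 0.

Fact bilinear0_is_bilinear : bilinear_for *:%R *:%R bilinear0.
Proof.
by split=> [y c x1 x2|x c y1 y2]; rewrite /bilinear0 addr0 [RHS]scaler0.
Qed.

HB.instance Definition _ := bilinear_isBilinear.Build K A A A _ _
  bilinear0 bilinear0_is_bilinear.

Definition ext0_mul (mu_ : 'I_n.+1 -> {bilinear A -> A -> A}) (p : 'I_n.+2) :
    {bilinear A -> A -> A} :=
  if unlift ord_max p is Some q then mu_ q else bilinear0.

Definition ext0_map (f_ : 'I_n.+1 -> {linear A -> A}) (p : 'I_n.+2) :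
    {linear A -> A} :=
  if unlift ord_max p is Some q then f_ q else (\0 : {linear A -> A}).

Definition trunc (x : At) : trunc_series A n := [ffun m => x (widen m)].

Lemma unlift_max_widen (p : 'I_n.+1) : unlift ord_max (widen p) = Some p.
Proof.
rewrite (_ : widen p = lift ord_max p) ?liftK //.
exact/val_inj/esym/lift_max.
Qed.

Lemma ext0_mul_widen mu_ p : ext0_mul mu_ (widen p) = mu_ p.
Proof. by rewrite /ext0_mul unlift_max_widen. Qed.

Lemma ext0_mul_max mu_ a b : ext0_mul mu_ ord_max a b = 0.
Proof. by rewrite /ext0_mul unlift_none. Qed.

Lemma ext0_map_widen f_ p : ext0_map f_ (widen p) = f_ p.
Proof. by rewrite /ext0_map unlift_max_widen. Qed.

Lemma ext0_map_max f_ a : ext0_map f_ ord_max a = 0.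
Proof. by rewrite /ext0_map unlift_none. Qed.

Lemma widen0 : widen ord0 = ord0.
Proof. exact: val_inj. Qed.

Lemma trunc_top_only z : trunc z = 0 -> top_only z.
Proof.
move=> tz0 m; case: (unliftP ord_max m) => [k -> _|->]; last by rewrite eqxx.
have -> : lift ord_max k = widen k by apply/val_inj/lift_max.
by move/ffunP: tz0 => /(_ k); rewrite !ffunE.
Qed.

Lemma truncB x y : trunc (x - y) = trunc x - trunc y.
Proof. by apply/ffunP => m; rewrite !ffunE. Qed.

Lemma trunc_sum (I : Type) (r : seq I) (P : pred I) (x : I -> At) :
  trunc (\sum_(i <- r | P i) x i) = \sum_(i <- r | P i) trunc (x i).
Proof.
apply: (big_morph trunc) => [y z|]; apply/ffunP => m; by rewrite !ffunE.
Qed.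

(** An index n+1 cannot contribute to a coefficient of degree at most n. With [trunc_map], this
    makes reduction modulo t^{n+1} carry the extended operations to the given ones. *)
Lemma trunc_mul mu_ x y :
  trunc (ts_mul (ext0_mul mu_) x y) = ts_mul mu_ (trunc x) (trunc y).
Proof.
apply/ffunP => m; rewrite !ffunE big_drop_max => [|_]; last first.
  by apply: big1 => q _; apply: big1 => r _; rewrite ext0_mul_max.
apply: eq_bigr => p _; rewrite big_drop_max => [|_]; last first.
  apply: big_pred0 => r; apply/eqP => e.
  by move: (ltn_ord m); rewrite -[X in (X < _)%N]e ltnNge addnAC leq_addl.
apply: eq_bigr => q _; rewrite big_drop_max => [|/eqP e]; last first.
  by move: (ltn_ord m); rewrite -[X in (X < _)%N]e ltnNge leq_addl.
by apply: eq_bigr => r _; rewrite ext0_mul_widen !ffunE.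
Qed.

Lemma trunc_map f_ x : trunc (ts_map (ext0_map f_) x) = ts_map f_ (trunc x).
Proof.
apply/ffunP => m; rewrite !ffunE big_drop_max => [|_]; last first.
  by apply: big1 => q _; rewrite ext0_map_max.
apply: eq_bigr => p _; rewrite big_drop_max => [|/eqP e]; last first.
  by move: (ltn_ord m); rewrite -[X in (X < _)%N]e ltnNge leq_addl.
by apply: eq_bigr => q _; rewrite ext0_map_widen !ffunE.
Qed.

End ExtensionByZero.

(** * The obstruction as top coefficient of the defects, and its cocycle identities *)

Section Obstruction.
Set Implicit Arguments.
Variables (K : fieldType) (A : lmodType K) (N n : nat).
Variables (mu : {bilinear A -> A -> A}) (d : 'I_N -> {linear A -> A}).
Variables (mu_ : 'I_n.+1 -> {bilinear A -> A -> A}).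
Variables (d_ : 'I_N -> 'I_n.+1 -> {linear A -> A}).
Hypothesis defA : deformation mu d mu_ d_.
Local Notation widen := (widen_ord (leqnSn n.+1)).
Local Notation At := (trunc_series A n.+1).
Let mut : {bilinear At -> At -> At} := ts_mul (ext0_mul mu_).
Let dt (k : 'I_N) : {linear At -> At} := ts_map (ext0_map (d_ k)).

Let mu0E a b : ext0_mul mu_ ord0 a b = mu a b.
Proof. by rewrite -widen0 ext0_mul_widen (deformation_mu0 defA). Qed.

Let mut_at0 (x y : At) : mut x y ord0 = mu (x ord0) (y ord0).
Proof. by rewrite ts_mul_at0 mu0E. Qed.

Let dt_at0 k (x : At) : dt k x ord0 = d k (x ord0).
Proof.
by rewrite ts_map_at0 -widen0 ext0_map_widen (deformation_d0 defA).
Qed.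

Let withd0_at0 i (x : At) : withd0 dt i x ord0 = withd0 d i (x ord0).
Proof. by rewrite /withd0; case: unlift => [k|] //; apply: dt_at0. Qed.

Let trunc_withd0 i (x : At) :
  trunc (withd0 dt i x) = withd0 (fun k => ts_map (d_ k)) i (trunc x).
Proof. by rewrite /withd0; case: unlift => [k|] //; apply: trunc_map. Qed.

Let associator_top x y z : top_only (associator mut x y z).
Proof.
apply: trunc_top_only; rewrite truncB !trunc_mul.
by rewrite (AssHDer_assoc (deformation_pair defA)) subrr.
Qed.

Let leibniz_top k x y : top_only (leibniz_defect mut dt k x y).
Proof.
apply: trunc_top_only; rewrite truncB trunc_map trunc_mul.
rewrite (AssHDer_hder (deformation_pair defA)) trunc_sum -sumrB big1 // => i _.
rewrite trunc_sum -sumrB big1 // => j _.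
by rewrite trunc_mul !trunc_withd0 subrr.
Qed.

Let associator_const a b c :
  associator mut (ts_const a) (ts_const b) (ts_const c) ord_max = Ob3 mu_ a b c.
Proof.
rewrite ts_coefB ts_mul_constr ts_mul_constl.
under eq_bigr do under eq_bigr do rewrite ts_mul_const.
under [X in _ - X]eq_bigr do under eq_bigr do rewrite ts_mul_const.
rewrite !convol_drop_max => [|q|p|q|p]; last first.
- by rewrite ext0_mul_max linear0l.
- by rewrite ext0_mul_max.
- by rewrite ext0_mul_max linear0r.
- by rewrite ext0_mul_max.
rewrite -sumrB; apply: eq_bigr => p _; rewrite -sumrB; apply: eq_bigr => q _.
by rewrite !ext0_mul_widen.
Qed.

Let withd0_const_widen i a q :
  withd0 dt i (ts_const a) (widen q) = withd0_coef d_ i q a.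
Proof.
rewrite /withd0 /withd0_coef; case: unlift => [k|] /=.
  by rewrite ts_map_const ext0_map_widen.
by rewrite ffunE -!val_eqE /=; case: eqP.
Qed.

Let withd0_const_max i a : withd0 dt i (ts_const a) ord_max = 0.
Proof.
rewrite /withd0; case: unlift => [k|] /=; last by rewrite ffunE.
by rewrite ts_map_const ext0_map_max.
Qed.

Let leibniz_const k a b :
  leibniz_defect mut dt k (ts_const a) (ts_const b) ord_max = Obk2 mu_ d_ k a b.
Proof.
rewrite ts_coefB; congr (_ - _).
  rewrite ffunE.
  under eq_bigr do under eq_bigr do rewrite ts_mul_const.
  rewrite convol_drop_max => [|q|p]; last first.
  - by rewrite ext0_mul_max linear0.
  - by rewrite ext0_map_max.
  apply: eq_bigr => p _; apply: eq_bigr => q _.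
  by rewrite ext0_map_widen ext0_mul_widen.
rewrite ts_coef_sum; apply: eq_bigr => i _.
rewrite ts_coef_sum; apply: eq_bigr => j _.
rewrite ffunE big_drop_max => [|_]; last first.
  by apply: big1 => q _; apply: big1 => r _; rewrite ext0_mul_max.
apply: eq_bigr => p _; rewrite big_drop_max => [|_]; last first.
  by apply: big1 => r _; rewrite withd0_const_max linear0l.
apply: eq_bigr => q _; rewrite big_drop_max => [|_]; last first.
  by rewrite withd0_const_max linear0r.
apply: eq_bigr => r _.
by rewrite ext0_mul_widen !withd0_const_widen.
Qed.

(** [linear_top_valued] replaces the arguments one slot at a time by their constant terms, which
    reduces to [associator_const]. *)
Let associator_max x y z :
  associator mut x y z ord_max = Ob3 mu_ (x ord0) (y ord0) (z ord0).
Proof.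
rewrite -associator_const.
rewrite (linear_top_valued (F := fun x => associator mut x y z)) //;
  last exact: associator_linear1.
rewrite (linear_top_valued (F := fun y => associator mut _ y z)) //;
  last exact: associator_linear2.
rewrite (linear_top_valued (F := associator mut _ _)) //.
exact: associator_linear3.
Qed.

Let leibniz_max k x y :
  leibniz_defect mut dt k x y ord_max = Obk2 mu_ d_ k (x ord0) (y ord0).
Proof.
rewrite -leibniz_const.
rewrite (linear_top_valued (F := fun x => leibniz_defect mut dt k x y)) //;
  last exact: leibniz_defect_linear1.
rewrite (linear_top_valued (F := leibniz_defect mut dt k _)) //.
exact: leibniz_defect_linear2.
Qed.

(** Top coefficient of the pentagon at constant series. An inner product of constants need not be
    constant, but [associator_max] reads only its constant term, given by [mu]. *)
Lemma Ob3_cocycle a b c e :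
  mu a (Ob3 mu_ b c e) - Ob3 mu_ (mu a b) c e + Ob3 mu_ a (mu b c) e
  - Ob3 mu_ a b (mu c e) + mu (Ob3 mu_ a b c) e = 0.
Proof.
have constK x : (ts_const x : At) ord0 = x by rewrite ffunE eqxx.
have := associator_pentagon mut (ts_const a) (ts_const b) (ts_const c)
  (ts_const e).
(* Abstracting the associator keeps the coefficient rewrites from unfolding it; only its top
   coefficient and its vanishing below are used. *)
move: (associator mut) associator_max associator_top => f fE ftop.
move/ffunP/(_ ord_max); rewrite !(ts_coefD, ts_coefN) [RHS]ffunE.
rewrite (ts_mul_topr _ _ (ftop _ _ _)) (ts_mul_topl _ _ (ftop _ _ _)) !fE.
by rewrite !mut_at0 !mu0E !constK.
Qed.

(** Top coefficient of [leibniz_defect_associator] at constant series, read off as in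
    [Ob3_cocycle]. *)
Lemma Obk2_cocycle (k : 'I_N) a b c :
  d k (Ob3 mu_ a b c)
  - \sum_(i < N.+1) \sum_(j < N.+1) \sum_(l < N.+1 | (i + j + l == k.+1)%N)
      Ob3 mu_ (withd0 d i a) (withd0 d j b) (withd0 d l c) =
  Obk2 mu_ d_ k (mu a b) c
  + \sum_(i < N) \sum_(j < N.+1 | (i.+1 + j == k.+1)%N)
      mu (Obk2 mu_ d_ i a b) (withd0 d j c)
  - Obk2 mu_ d_ k a (mu b c)
  - \sum_(i < N.+1) \sum_(j < N | (i + j.+1 == k.+1)%N)
      mu (withd0 d i a) (Obk2 mu_ d_ j b c).
Proof.
have constK x : (ts_const x : At) ord0 = x by rewrite ffunE eqxx.
have := leibniz_defect_associator mut dt k (ts_const a) (ts_const b)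
  (ts_const c).
move: (associator mut) (leibniz_defect mut dt) associator_max associator_top
  leibniz_max leibniz_top => f g fE ftop gE gtop.
move/ffunP/(_ ord_max); rewrite !(ts_coefD, ts_coefN) !ts_coef_sum.
rewrite (ts_map_top _ (ftop _ _ _)) !fE !gE !mut_at0 !constK.
rewrite -widen0 ext0_map_widen (deformation_d0 defA) => eq_max.
rewrite [X in _ - X](_ : _ = \sum_(i < N.+1) (\sum_(j < N.+1)
   \sum_(l < N.+1 | (i + j + l == k.+1)%N)
      f (withd0 dt i (ts_const a)) (withd0 dt j (ts_const b))
        (withd0 dt l (ts_const c))) ord_max); last first.
  apply: eq_bigr => i _; rewrite ts_coef_sum; apply: eq_bigr => j _.
  rewrite ts_coef_sum; apply: eq_bigr => l _.
  by rewrite fE !withd0_at0 !constK.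
rewrite eq_max; congr (_ + _ - _ - _); apply: eq_bigr => i _.
  rewrite ts_coef_sum; apply: eq_bigr => j _.
  by rewrite (ts_mul_topl _ _ (gtop _ _ _)) mu0E gE withd0_at0 !constK.
rewrite ts_coef_sum; apply: eq_bigr => j _.
by rewrite (ts_mul_topr _ _ (gtop _ _ _)) mu0E gE withd0_at0 !constK.
Qed.

End Obstruction.

(** * Multilinearity of the obstruction cochains *)

Section Multilinearity.
Set Implicit Arguments.
Variables (K : fieldType) (A : lmodType K) (N n : nat).
Variables (mu_ : 'I_n.+1 -> {bilinear A -> A -> A}).
Variables (d_ : 'I_N -> 'I_n.+1 -> {linear A -> A}).

Let mu_linearl p b : linear (fun a => mu_ p a b).
Proof. exact: linear_bilinearl. Qed.

Let mu_linearr p a : linear (mu_ p a).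
Proof. exact: linear_bilinearr. Qed.

Lemma Ob_multilinear : multilinear (Ob mu_).
Proof.
(* One case per argument slot: once the index tests are computed, the variable sits in a single
   explicit place. *)
case=> [[|[|[|i]]] lti] // v c x y; rewrite /Ob !ffunE -!val_eqE /= !inordK //=;
  move: c x y; apply: linear_sum_fun => p; apply: linear_sum_fun => q;
  apply: linear_sub_fun; do ?[exact: mu_linearl | exact: mu_linearr
    | exact/linear_bilinearl/mu_linearl | exact/linear_bilinearl/mu_linearr
    | exact/linear_bilinearr/mu_linearl | exact/linear_bilinearr/mu_linearr].
Qed.

Lemma Obk_multilinear k : multilinear (Obk mu_ d_ k).
Proof.
case=> [[|[|i]] lti] // v c x y; rewrite /Obk !ffunE -!val_eqE /= !inordK //=;
  move: c x y; apply: linear_sub_fun; apply: linear_sum_fun => i;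
  apply: linear_sum_fun => j; do ?[exact/linear_comp_fun/mu_linearl
    | exact/linear_comp_fun/mu_linearr];
  apply: linear_sum_fun => p; apply: linear_sum_fun => q;
  apply: linear_sum_fun => r;
  do ?[apply: linear_bilinearl => c x y; rewrite linearP
      |apply: linear_bilinearr => c x y; rewrite linearP] => //.
Qed.

End Multilinearity.

Theorem proposition6p7 (K : fieldType) (charK0 : [pchar K] =i pred0)
    (A : lmodType K) (N : nat) (N_gt0 : (0 < N)%N)
    (mu : {bilinear A -> A -> A}) (d : 'I_N -> {linear A -> A})
    (pairA : AssHDer_pair mu d)
    (n : nat) (mu_ : 'I_n.+1 -> {bilinear A -> A -> A})
    (d_ : 'I_N -> 'I_n.+1 -> {linear A -> A})
    (defA : deformation mu d mu_ d_) :
  cocycle mu d (n := 3) (Ob mu_, Obk mu_ d_).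
Proof.
have signE m (x : A) : (-1) ^+ m *: x = if odd m then - x else x.
  by rewrite -signr_odd; case: odd; rewrite ?expr1 ?scaleN1r ?expr0 ?scale1r.
split; [split=> [|k] | split=> [v|k v]] => /=.
- exact: Ob_multilinear.
- exact: Obk_multilinear.
(* Hochschild component: for three arguments the signs are +, -, +, -, +, as in the pentagon. *)
- rewrite /delta_Hoch !big_ord_recl big_ord0 addr0 !signE /= !addrA.
  rewrite -[RHS](Ob3_cocycle defA (v ord0) (v (inord 1)) (v (inord 2))
                  (v ord_max)).
  rewrite /Ob !ffunE -!val_eqE /= !inordK //=.
  by do ?[congr (_ + _) | congr (- _) | congr (mu _ _) | congr (Ob3 mu_ _ _ _)
    | congr (v _)]; apply: val_inj; rewrite /= ?inordK.
(* Remaining components: the equations below translate the argument lists of the complex into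
   explicit arguments. *)
have inord2 : ord_max = inord 2 :> 'I_3 by apply: val_inj; rewrite /= inordK.
have ObE : Ob mu_ v = Ob3 mu_ (v ord0) (v (inord 1)) (v ord_max).
  by rewrite inord2.
have Ob_withd0 (i j l : 'I_N.+1) :
    let t := [ffun m : 'I_3 => nth i [:: i; j; l] m] in
    Ob mu_ [ffun m => withd0 d (t m) (v m)] =
    Ob3 mu_ (withd0 d i (v ord0)) (withd0 d j (v (inord 1)))
      (withd0 d l (v ord_max)).
  by rewrite /Ob !ffunE /= !inordK // inord2.
have Obk_first j :
    Obk mu_ d_ j (all_but_first v) = Obk2 mu_ d_ j (v (inord 1)) (v ord_max).
  rewrite /Obk !ffunE; congr (Obk2 mu_ d_ j (v _) (v _)); apply: val_inj;
  by rewrite /= ?inordK.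
have Obk_last j :
    Obk mu_ d_ j (all_but_last v) = Obk2 mu_ d_ j (v ord0) (v (inord 1)).
  rewrite /Obk !ffunE; congr (Obk2 mu_ d_ j (v _) (v _)); apply: val_inj;
  by rewrite /= ?inordK.
have Obk_contract0 : Obk mu_ d_ k (contract mu v ord0) =
    Obk2 mu_ d_ k (mu (v ord0) (v (inord 1))) (v ord_max).
  rewrite /Obk !ffunE -!val_eqE /= !inordK //=.
  by congr (Obk2 mu_ d_ k (mu (v _) (v _)) (v _)); apply: val_inj;
    rewrite /= ?inordK.
have Obk_contract1 : Obk mu_ d_ k (contract mu v (lift ord0 ord0)) =
    Obk2 mu_ d_ k (v ord0) (mu (v (inord 1)) (v ord_max)).
  rewrite /Obk !ffunE -!val_eqE /= !inordK //=.
  by congr (Obk2 mu_ d_ k (v _) (mu (v _) (v _))); apply: val_inj;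
    rewrite /= ?inordK.
rewrite /delta'_Hoch /delta signE /= sum_ffun3.
rewrite [\sum_(i < 2) _]big_ord_recl [\sum_(i < 1) _]big_ord_recl.
rewrite big_ord0 addr0 !signE /= Obk_contract0 Obk_contract1 ObE.
under eq_bigr do under eq_bigr do rewrite Obk_first.
under [\sum_(i < N) _]eq_bigr do under eq_bigr do rewrite Obk_last.
under [X in _ - (X - _)]eq_bigr => i _ do under eq_bigr => j _ do
  under eq_big => [l|l _] do
    [rewrite !big_ord_recl big_ord0 !ffunE addn0 addnA | rewrite Ob_withd0].
(* The sign (-1)^3 turns the [delta] term into the left side of [Obk2_cocycle]; its right side is
   the opposite of the [delta'_Hoch] term, so the two cancel. *)
rewrite [- (_ - d k _)]opprB (Obk2_cocycle defA).
move: (Obk2 mu_ d_ k _ _) (Obk2 mu_ d_ k _ _) => Q1 Q2.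
apply/eqP; rewrite addr_eq0 !opprB !opprD !addrA.
by rewrite (addrAC _ (- Q2)).
Qed.
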